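(* Let $G$ be a finite group whose irreducible complex representations have dimensions $n_\ell$ (one for each isomorphism class). Let $M=(V,E,F)$ be a connected map. Then the number of local $G$-flows of $M$ is $$q^1_G(M)=|G|^{|E|-|V|}\sum_{\ell}n_\ell^{\chi(M)},$$ where $\chi(M)=|V|-|E|+|F|$.
   Context: A connected map is a 2-cell embedding of a finite connected graph (loops and multiple edges allowed) in a closed connected oriented surface, equivalently a connected graph with a rotation system giving a cyclic (anticlockwise) order of the edge-ends at each vertex; $V,E,F$ are its vertices, edges and faces. Fix an arbitrary orientation of the edges. A local $G$-flow of $M$ is an assignment $\phi:E\to G$ (identity values allowed) such that at each vertex $v$ the product of the values $\phi(e)^{\pm1}$ over the edge-ends at $v$, taken in the anticlockwise cyclic order around $v$, with exponent $-1$ where the edge is incoming at that end and $+1$ where it is outgoing, equals the identity (a loop contributes twice, once outgoing and once incoming). $q^1_G(M)$ denotes the number of local $G$-flows; it does not depend on the chosen orientation. *)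

(* Defs.v *)
From HB Require Import structures.
From mathcomp Require Import all_boot all_order all_algebra all_fingroup.
From mathcomp Require Import mxrepresentation reals complex.

Set Implicit Arguments.
Unset Strict Implicit.
Unset Printing Implicit Defensive.

Import GRing.Theory.
Local Open Scope ring_scope.

(* A graph with a rotation system. Each edge e has the two edge-ends (e, true)
   and (e, false), so loops and multiple edges are allowed. [mrot] sends an
   edge-end to the next one anticlockwise around its vertex: its cycles are
   the fibres of [mend]. A vertex with no edge-end is allowed. *)
Record rotation_map := RotationMap {
  mvertex : finType;
  medge : finType;
  mend : medge * bool -> mvertex;
  mrot : {perm medge * bool};
  mrotP : forall d d' : medge * bool,
    (d' \in porbit mrot d) = (mend d' == mend d)
}.

Definition flip (E : Type) (d : E * bool) : E * bool := (d.1, ~~ d.2).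

Lemma flipK (E : Type) : involutive (@flip E).
Proof. by case=> e b; rewrite /flip /= negbK. Qed.

Definition flip_perm (E : finType) : {perm E * bool} :=
  perm (inv_inj (@flipK E)).

Section Maps.

Variable M : rotation_map.

Definition madj : rel (mvertex M) :=
  [rel v w | [exists d : medge M * bool,
     (mend d == v) && (mend (flip d) == w)]].

Definition connected_map : Prop :=
  (0 < #|mvertex M|)%N /\ forall v w : mvertex M, connect madj v w.

(* Products of permutations act left factor first: cross the edge, then turn
   to the next edge-end around the vertex reached. The cycles are the
   boundary walks of the faces. *)
Definition face_perm : {perm medge M * bool} := (flip_perm (medge M) * mrot M)%g.

(* A vertex with no edge-end is a component embedded in a sphere, whose single
   face is not seen by [face_perm]. *)
Definition isolated : {set mvertex M} :=
  [set v | [forall d : medge M * bool, mend d != v]].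

Definition nfaces : nat := (#|porbits face_perm| + #|isolated|)%N.

Definition euler_char : int :=
  #|mvertex M|%:Z - #|medge M|%:Z + nfaces%:Z.

Variables (gT : finGroupType) (G : {group gT}).

(* (e, o e) is the outgoing end of e in the orientation o. *)
Definition end_value (o : medge M -> bool) (phi : medge M -> gT)
    (d : medge M * bool) : gT :=
  if d.2 == o d.1 then phi d.1 else (phi d.1)^-1%g.

(* [fingraph.orbit (mrot M) d] lists the edge-ends at the vertex of d in anticlockwise
   order from d. Changing the start only conjugates the product, so requiring
   the condition for every start d is the same as for one. *)
Definition flow_at (o : medge M -> bool) (phi : medge M -> gT)
    (v : mvertex M) : bool :=
  [forall (d | mend d == v),
     (\prod_(x <- fingraph.orbit (mrot M) d) end_value o phi x)%g == 1%g].

Definition local_flows (o : medge M -> bool) : {set {ffun medge M -> gT}} :=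
  [set phi in ffun_on (mem G) | [forall v, flow_at o phi v]].

End Maps.

(* [rho] contains exactly one representative of each isomorphism class of
   irreducible representations of [G] over the field [C]. *)
Record irrep_classes (C : fieldType) (gT : finGroupType) (G : {group gT})
    (L : finType) (n : L -> nat)
    (rho : forall l : L, mx_representation C G (n l)) : Prop := {
  irrep_irr : forall l : L, mx_irreducible (rho l);
  irrep_inj : forall k l : L, mx_rsim (rho k) (rho l) -> k = l;
  irrep_all : forall (m : nat) (r : mx_representation C G m),
    mx_irreducible r -> exists l : L, mx_rsim r (rho l)
}.

(* Main.v *)
Require Import Defs.
From HB Require Import structures.
From mathcomp Require Import all_boot all_order all_algebra all_fingroup.
From mathcomp Require Import mxrepresentation reals complex.
From mathcomp Require Import pgroup.

Set Implicit Arguments.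
Unset Strict Implicit.
Unset Printing Implicit Defensive.

Import GRing.Theory.
Local Open Scope ring_scope.

(* By column orthogonality, the indicator of the identity of [G] is
   [#|G|^-1 * \sum_l n_l * tr (rho_l x)].  Inserting this at every vertex and
   expanding the traces of products into matrix entries gives a sum over all
   ways of putting an irreducible representation and a row index at each
   edge-end.  Summing over the flow value of one edge, Schur orthogonality
   forces the labels to agree along the two sides of this edge and contributes
   [#|G| / n_l].  So only labellings constant on faces survive; connectedness
   makes the irreducible [l] the same everywhere, and there remain
   [n_l ^ faces] labellings, each of weight
   [(n_l / #|G|) ^ vertices * (#|G| / n_l) ^ edges]. *)

(** * Sums over labellings with prescribed support *)

Section SupportedFunctions.

Variables (D T : finType) (t0 : T).
Implicit Types (h i : {ffun D -> T}).

(** A labelling of the subset [A] is encoded as a labelling of all of [D] with the default value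
    [t0] off [A], so that labellings of different subsets share one type. *)
Definition supported (A : pred D) h : bool :=
  [forall d, A d || (h d == t0)].

Lemma supportedP (A : pred D) h :
  reflect (forall d, ~~ A d -> h d = t0) (supported A h).
Proof.
apply: (iffP forallP) => [supp d /negbTE nAd | supp d].
  by have := supp d; rewrite nAd => /eqP.
by have [//|/supp->/=] := boolP (A d).
Qed.

Definition update h (x : D) (t : T) : {ffun D -> T} :=
  [ffun d => if d == x then t else h d].

Definition restrict (A : pred D) h : {ffun D -> T} :=
  [ffun d => if A d then h d else t0].

Variable C : comNzRingType.

Lemma sum_supported0 (F : {ffun D -> T} -> C) :
  \sum_(h | supported pred0 h) F h = F [ffun=> t0].
Proof.
rewrite (big_pred1 [ffun=> t0]) // => h; apply/supportedP/eqP => [supp|-> d _].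
  by apply/ffunP=> d; rewrite ffunE supp.
by rewrite ffunE.
Qed.

(** Splitting off the label at [x] is a bijection: its inverse pairs [h x] with [h] reset to [t0] at
    [x]. *)
Lemma sum_supported_cons (x : D) (s : seq D) (F : {ffun D -> T} -> C) :
  x \notin s ->
  \sum_(h | supported (mem (x :: s)) h) F h =
  \sum_(t : T) \sum_(h | supported (mem s) h) F (update h x t).
Proof.
move=> s'x; rewrite pair_big_dep /=.
rewrite (reindex_onto (fun p : T * {ffun D -> T} => update p.2 x p.1)
  (fun h => (h x, update h x t0))) /= => [|h _]; last first.
  by apply/ffunP=> d; rewrite !ffunE; case: eqP => // ->.
apply: eq_bigl => -[t h] /=; rewrite xpair_eqE !ffunE !eqxx /=.
apply/andP/supportedP => [[/supportedP supp /eqP <-] d sd|supp].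
  rewrite !ffunE; have [//|ne_dx] := eqVneq.
  have := supp d; rewrite !ffunE (negbTE ne_dx); apply.
  by rewrite /= inE negb_or ne_dx.
split; first apply/supportedP=> d.
  by rewrite /= inE negb_or ffunE => /andP[/negbTE-> /supp].
by apply/eqP/ffunP=> d; rewrite !ffunE; case: eqP => // ->; rewrite supp.
Qed.

(** The fibres of [p] partition [D], so one labelling per fibre glues uniquely to a labelling of
    [D]. This is distributivity of the product over the sums, read through that gluing. *)
Lemma prod_sum_supported (V : finType) (p : D -> V)
    (F : V -> {ffun D -> T} -> C) :
  (forall v h h', (forall d, p d = v -> h d = h' d) -> F v h = F v h') ->
  \prod_v \sum_(h | supported [pred d | p d == v] h) F v h =
  \sum_h \prod_v F v h.
Proof.
move=> locF; rewrite bigA_distr_big_dep.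
rewrite (reindex_onto
  (fun h : {ffun D -> T} => [ffun v => restrict [pred d | p d == v] h])
  (fun f => [ffun d => f (p d) d])) /= => [|f /familyP famf]; last first.
  apply/ffunP=> v; apply/ffunP=> d; rewrite !ffunE /=.
  case: eqP => [<-//|/eqP ne_v].
  by have /supportedP-> := famf v.
apply: eq_big => [h|h _].
  apply/andP; split.
    apply/familyP=> v; rewrite ffunE; apply/supportedP=> d /= /negbTE ne_v.
    by rewrite ffunE /= ne_v.
  by apply/eqP/ffunP=> d; rewrite !ffunE /= eqxx.
apply: eq_bigr => v _; rewrite ffunE; apply: locF => d /eqP eq_v.
by rewrite ffunE /= eq_v.
Qed.

(** An invariant labelling factors through the cycles of [f], which leaves one free choice in [B]
    for each cycle. *)
Lemma card_cycle_invariant (f : {perm D}) (B : pred T) :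
  #|[set h : {ffun D -> T} |
      [forall d, B (h d)] && [forall d, h (f d) == h d]]| =
    (#|B| ^ #|porbits f|)%N.
Proof.
rewrite -(card_pffun_on t0 (porbits f) B).
pose lift (k : {ffun {set D} -> T}) : {ffun D -> T} := [ffun d => k (porbit f d)].
rewrite -(card_in_imset (f := lift)) => [|k k' /pfamilyP[suppk _]]; last first.
  move=> /pfamilyP[suppk' _] eqk; apply/ffunP=> X.
  have [/imsetP[d _ ->]|nX] := boolP (X \in porbits f).
    by have /ffunP/(_ d) := eqk; rewrite !ffunE.
  by rewrite (supportP suppk) // (supportP suppk').
apply: eq_card => h; rewrite inE.
apply/andP/imsetP => [[/forallP Bh /forallP fh]|[k /pfamilyP[_ Bk] ->]].
  have inv d d' : d' \in porbit f d -> h d' = h d.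
    case/porbitP=> m ->; elim: m => [|m IHm]; first by rewrite perm1.
    by rewrite expgSr permM (eqP (fh _)).
  (* The value on a cycle is read at any of its points; sets that are not cycles get [t0], as the
     support condition of [pffun_on] demands. *)
  exists [ffun X : {set D} =>
            if X \in porbits f then
              if [pick d in X] is Some d then h d else t0
            else t0].
    apply/pfamilyP; split=> [|X /imsetP[d _ ->]].
      by apply/supportP=> X nX; rewrite ffunE (negbTE nX).
    rewrite ffunE imset_f //; case: pickP => [d' _|/(_ d)]; first exact: Bh.
    by rewrite porbit_id.
  apply/ffunP=> d; rewrite !ffunE imset_f //.
  case: pickP => [d' d'd|/(_ d)]; last by rewrite porbit_id.
  by rewrite (inv _ _ d'd).
split; apply/forallP=> d; first by rewrite ffunE; apply/Bk/imset_f.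
rewrite !ffunE; apply/eqP; congr (k _); apply/eqP.
by rewrite eq_porbit_mem; have := mem_porbit f 1 d; rewrite expg1.
Qed.

End SupportedFunctions.

(** * Schur orthogonality and the regular character *)

Section Irreps.

Variables (C : numClosedFieldType) (gT : finGroupType) (G : {group gT}).

Lemma natf_card_neq0 : (#|G|%:R : C) != 0.
Proof. by rewrite Num.Theory.pnatr_eq0 -lt0n cardG_gt0. Qed.

Lemma irr_gt0 (m : nat) (r : mx_representation C G m) :
  mx_irreducible r -> (0 < m)%N.
Proof. by case/mx_irrP. Qed.

Lemma irr_nat_neq0 (m : nat) (r : mx_representation C G m) :
  mx_irreducible r -> (m%:R : C) != 0.
Proof. by move=> /irr_gt0; rewrite Num.Theory.pnatr_eq0 -lt0n. Qed.

(** Schur's lemma: the kernel of [B] is a proper submodule of [r], hence zero, and its image is a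
    nonzero submodule of [s], hence everything; so [B] is invertible. *)
Lemma schur_rsim (k m : nat) (r : mx_representation C G k)
    (s : mx_representation C G m) (B : 'M[C]_(k, m)) :
  mx_irreducible r -> mx_irreducible s ->
  (forall x, x \in G -> r x *m B = B *m s x) -> B != 0 -> mx_rsim r s.
Proof.
move=> /mx_irrP[k_gt0 irr_r] /mx_irrP[m_gt0 irr_s] homB nzB.
have freeB : row_free B.
  rewrite -kermx_eq0; apply: contraNT nzB => nz_ker.
  have modK : mxmodule r (kermx B).
    apply/mxmoduleP=> x Gx; apply/sub_kermxP.
    by rewrite -mulmxA homB // mulmxA mulmx_ker mul0mx.
  have := irr_r _ modK nz_ker; rewrite -sub1mx => /sub_kermxP.
  by rewrite mul1mx => ->.
have fullB : row_full <<B>>%MS.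
  apply: irr_s; last by rewrite (eqmx_eq0 (genmxE _)).
  rewrite (eqmx_module _ (genmxE _)); apply/mxmoduleP=> x Gx.
  by rewrite -homB // submxMl.
exists B => //; rewrite -(eqP freeB).
by move: fullB; rewrite /row_full genmxE => /eqP.
Qed.

Lemma intertwiner_sum (k m : nat) (r : mx_representation C G k)
    (s : mx_representation C G m) (A : 'M[C]_(k, m)) (x : gT) : x \in G ->
  r x *m (\sum_(g in G) r g *m A *m s g^-1%g) =
  (\sum_(g in G) r g *m A *m s g^-1%g) *m s x.
Proof.
move=> Gx; rewrite mulmx_sumr mulmx_suml.
rewrite [RHS](reindex_inj (mulgI x)) /=.
apply: eq_big => [g|g Gg]; first by rewrite groupMl.
rewrite !mulmxA -repr_mxM // -!mulmxA -repr_mxM ?groupV ?groupM //.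
by rewrite invMg mulgKV.
Qed.

(** Averaging an elementary matrix turns the sums of the orthogonality relations into entries of an
    intertwiner. *)
Lemma sum_delta_entry (k m : nat) (r : mx_representation C G k)
    (s : mx_representation C G m) (i j : 'I_k) (p q : 'I_m) :
  (\sum_(g in G) r g *m delta_mx j p *m s g^-1%g) i q =
  \sum_(g in G) r g i j * s g^-1%g p q.
Proof.
rewrite summxE; apply: eq_bigr => g Gg.
(* The elementary matrix is split as a column times a row, which isolates one column of [r g] and
   one row of [s g^-1]. *)
rewrite -(mul_delta_mx (0 : 'I_1)) mulmxA -mulmxA mxE big_ord1.
by rewrite -colE -rowE !mxE.
Qed.

Lemma schur_orthogonality_neq (k m : nat) (r : mx_representation C G k)
    (s : mx_representation C G m) (i j : 'I_k) (p q : 'I_m) :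
  mx_irreducible r -> mx_irreducible s -> ~ mx_rsim r s ->
  \sum_(g in G) r g i j * s g^-1%g p q = 0.
Proof.
move=> irr_r irr_s nsim; rewrite -sum_delta_entry.
have [->|nz] := eqVneq (\sum_(g in G) r g *m delta_mx j p *m s g^-1%g) 0.
  by rewrite mxE.
case: nsim; apply: schur_rsim irr_r irr_s _ nz => x Gx.
exact: intertwiner_sum.
Qed.

(** The averaged matrix commutes with [r], so it is a scalar over the closed field. Its trace
    determines the scalar, since conjugation preserves the trace of [delta_mx j p]. *)
Lemma schur_orthogonality_eq (k : nat) (r : mx_representation C G k)
    (i j p q : 'I_k) : mx_irreducible r ->
  \sum_(g in G) r g i j * r g^-1%g p q =
  #|G|%:R / k%:R * ((i == q) && (j == p))%:R.
Proof.
move=> irr_r; rewrite -sum_delta_entry.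
set B := \sum_(g in G) _.
have /is_scalar_mxP[a defB] : is_scalar_mx B.
  apply: (mx_abs_irr_cent_scalar (group_closure_closed_field irr_r)).
  by apply/centgmxP=> x Gx; rewrite [RHS]intertwiner_sum.
have trB : a *+ k = #|G|%:R * (j == p)%:R.
  rewrite -mxtrace_scalar -defB raddf_sum /=.
  rewrite (eq_bigr (fun=> (j == p)%:R)) => [|g Gg].
    by rewrite sumr_const mulr_natl.
  rewrite mxtrace_mulC mulmxA -repr_mxM ?groupV // mulVg repr_mx1 mul1mx.
  rewrite /mxtrace (bigD1 j) //= big1 => [|l /negbTE ne_lj].
    by rewrite !mxE eqxx addr0.
  by rewrite !mxE ne_lj.
have k_neq0 := irr_nat_neq0 irr_r.
have aE : a = #|G|%:R * (j == p)%:R / k%:R.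
  by rewrite -trB -[a *+ k]mulr_natr mulfK.
rewrite defB mxE aE mulrb; case: (i == q); last by rewrite mulr0.
by rewrite /= mulrAC.
Qed.

Variables (L : finType) (n : L -> nat).
Variable rho : forall l : L, mx_representation C G (n l).
Hypothesis Hrho : irrep_classes rho.

(** Both sides are the character of the regular representation: one from its decomposition, where
    each irreducible occurs as often as its dimension, the other from its permutation matrices. *)
Lemma sum_irr_trace (x : gT) : x \in G ->
  \sum_(l : L) (n l)%:R * \tr (rho l x) = #|G|%:R * (x == 1%g)%:R :> C.
Proof.
move=> Gx; have [irr_rho inj_rho all_rho] := Hrho.
pose aG := regular_repr C G; pose sG : irrType C G := DecSocleType aG.
have C'G : ([pchar C]%R^'.-group G)%g.
  by apply/pgroupP=> p _ _; rewrite inE /= Num.Theory.pchar_num.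
have splitG : group_splitting_field C G by apply: group_closure_closed_field.
have trE : \tr (aG x) = #|G|%:R * (x == 1%g)%:R.
  have [->|ntx] := eqVneq x 1%g.
    by rewrite repr_mx1 mxtrace1 mulr1.
  (* Multiplication by [x != 1] fixes no group element, so all diagonal entries vanish. *)
  rewrite mulr0 [LHS]big1 // => i _; rewrite 2!mxE /=.
  rewrite -(inj_eq enum_val_inj) gring_indexK ?groupM ?enum_valP //.
  by rewrite eq_mulVg1 mulKg (negbTE ntx).
rewrite -trE (mxtrace_regular_pchar sG) //.
(* [h] matches the given classes with the irreducible components of the regular representation; it
   is injective by [inj_rho] and surjective by [all_rho]. *)
pose h l : sG := irr_comp sG (rho l).
have simh l : mx_rsim (rho l) (irr_repr (h l)) by apply: rsim_irr_comp_pchar.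
have inj_h : injective h.
  move=> k l eqh; apply: inj_rho; apply: mx_rsim_trans (simh k) _.
  by rewrite eqh; apply: mx_rsim_sym.
have bij_h : bijective h.
  apply: (inj_card_bij inj_h); rewrite -(card_codom inj_h).
  apply/subset_leq_card/subsetP=> i _; apply/codomP.
  have [l sim_l] := all_rho _ _ (socle_irr i); exists l.
  by rewrite -[LHS](irr_reprK_pchar C'G); apply: irr_comp_rsim_pchar.
rewrite (reindex h) /=; last exact: onW_bij.
apply: eq_bigr => l _.
rewrite (mxtrace_rsim (simh l) Gx) mulr_natl.
by congr (_ *+ _); case: (simh l).
Qed.

(** * Matrix entries of the direct sum of all irreducibles *)

Local Notation T := {l : L & 'I_(n l)}.

(* Entries of the direct sum of the [rho l], with rows and columns indexed
   by [T]. *)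
Definition block_entry (g : gT) (t u : T) : C :=
  if tag t == tag u then rho (tag t) g (tagged t) (tagged_as t u) else 0.

Lemma block_entryE (g : gT) (l : L) (i j : 'I_(n l)) :
  block_entry g (Tagged _ i) (Tagged _ j) = rho l g i j.
Proof. by rewrite /block_entry /= eqxx tagged_asE. Qed.

Lemma block_entry0 (g : gT) (t u : T) : tag t != tag u -> block_entry g t u = 0.
Proof. by rewrite /block_entry => /negbTE->. Qed.

Lemma sum_tagged (F : T -> C) :
  \sum_(t : T) F t = \sum_(l : L) \sum_(i < n l) F (Tagged _ i).
Proof. by rewrite sig_big_dep; apply: eq_bigr => -[]. Qed.

Lemma block_entryM (g h : gT) (t u : T) : g \in G -> h \in G ->
  block_entry (g * h)%g t u = \sum_(w : T) block_entry g t w * block_entry h w u.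
Proof.
move=> Gg Gh; case: t => l i; rewrite sum_tagged (bigD1 l) //=.
rewrite [X in _ + X]big1 => [|k ne_kl]; last first.
  by apply: big1 => j _; rewrite block_entry0 ?mul0r //= eq_sym.
rewrite addr0; case: u => m j; have [eq_lm|ne_lm] := eqVneq l m.
  subst m; rewrite block_entryE repr_mxM // mxE.
  by apply: eq_bigr => w _; rewrite !block_entryE.
rewrite block_entry0 // big1 // => w _.
by rewrite [X in _ * X]block_entry0 ?mulr0.
Qed.

(** Both Schur relations in one formula. The conjunct on tags kills entries outside the diagonal
    blocks, where the two index equalities alone could still hold. *)
Lemma block_entry_orthogonality (t u t' u' : T) :
  \sum_(g in G) block_entry g t u * block_entry g^-1%g t' u' =
  #|G|%:R / (n (tag t))%:R * [&& tag t == tag u, t == u' & u == t']%:R.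
Proof.
have [irr_rho inj_rho _] := Hrho.
have [eq_tu|ne_tu] := eqVneq (tag t) (tag u); last first.
  by rewrite big1 ?mulr0 // => g _; rewrite block_entry0 ?mul0r.
have [eq_tu'|ne_tu'] := eqVneq (tag t') (tag u'); last first.
  rewrite big1 => [|g _]; last by rewrite [X in _ * X]block_entry0 ?mulr0.
  have [eq_t|] := eqVneq t u'; last by rewrite mulr0.
  have [eq_u|] := eqVneq u t'; last by rewrite mulr0.
  by rewrite -eq_t -eq_u eq_tu eqxx in ne_tu'.
case: t u t' u' eq_tu eq_tu' => [l i] [k j] [m p] [m' q] /= eq_lk eq_mm.
subst m' k.
under eq_bigr do rewrite !block_entryE.
have [eq_lm|ne_lm] := eqVneq l m.
  subst m; rewrite schur_orthogonality_eq //.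
  by rewrite !eq_Tagged.
rewrite schur_orthogonality_neq //; last first.
  by move=> /inj_rho eq_lm; rewrite eq_lm eqxx in ne_lm.
by rewrite -tag_eqE /tag_eq /= (negbTE ne_lm) mulr0.
Qed.

Lemma delta_block_entry (x : gT) : x \in G ->
  (x == 1%g)%:R = #|G|%:R^-1 * \sum_(t : T) (n (tag t))%:R * block_entry x t t.
Proof.
move=> Gx; rewrite sum_tagged.
rewrite (eq_bigr (fun l => (n l)%:R * \tr (rho l x))) => [|l _].
  by rewrite sum_irr_trace // mulKf ?natf_card_neq0.
by rewrite mulr_sumr; apply: eq_bigr => i _; rewrite block_entryE.
Qed.

(** * Expanding the trace of a product into labellings *)

Section PathExpansion.

Variables (D : finType) (t0 : T) (g : D -> gT).
Hypothesis Gg : forall d, g d \in G.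

(** One term in the expansion of an entry of a matrix product: [h] supplies the row index of each
    factor, and [u] is the column index of the last one. *)
Fixpoint path_weight (h : {ffun D -> T}) (x : D) (s : seq D) (u : T) : C :=
  if s is y :: s' then
    block_entry (g x) (h x) (h y) * path_weight h y s' u
  else block_entry (g x) (h x) u.

Lemma path_weight_local (h h' : {ffun D -> T}) (x : D) (s : seq D) (u : T) :
  {in x :: s, h =1 h'} -> path_weight h x s u = path_weight h' x s u.
Proof.
elim: s x => [|y s IHs] x eqh /=; first by rewrite eqh ?mem_head.
rewrite !eqh ?mem_head ?inE ?eqxx ?orbT //; congr (_ * _); apply: IHs => d sd.
by rewrite eqh // inE sd orbT.
Qed.

Lemma prod_in (s : seq D) : (\prod_(d <- s) g d)%g \in G.
Proof. by apply: group_prod => d _; apply: Gg. Qed.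

(** Repeated matrix multiplication. As the list has no repetition, the summation indices are
    independent labels on [s], while the row index at [x] is fixed to [t]. *)
Lemma block_entry_prod (x : D) (s : seq D) (t u : T) : uniq (x :: s) ->
  block_entry (\prod_(d <- x :: s) g d)%g t u =
  \sum_(h | supported t0 (mem s) h) path_weight (update h x t) x s u.
Proof.
elim: s x t => [|y s IHs] x t.
  move=> _; rewrite big_seq1.
  rewrite (eq_bigl (supported t0 pred0)) ?sum_supported0 //=.
  by rewrite !ffunE eqxx.
rewrite cons_uniq big_cons => /andP[s'x uys].
rewrite block_entryM ?prod_in // sum_supported_cons; last by case/andP: uys.
apply: eq_bigr => w _; rewrite IHs // mulr_sumr; apply: eq_bigr => h _ /=.
have ne_yx : (y == x) = false.
  by apply/negbTE; apply: contraNneq s'x => ->; rewrite mem_head.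
rewrite !ffunE ne_yx !eqxx; congr (_ * _); apply: path_weight_local => d sd.
rewrite [RHS]ffunE; case: eqP => // eq_dx.
by rewrite -eq_dx sd in s'x.
Qed.

(** Once the column index is the label of the successor, the order of the factors no longer matters;
    this is what later allows regrouping by edges. *)
Lemma path_weight_fpath (f : D -> D) (h : {ffun D -> T}) (x : D) (s : seq D) :
  fpath f x s ->
  path_weight h x s (h (f (last x s))) =
  \prod_(d <- x :: s) block_entry (g d) (h d) (h (f d)).
Proof.
elim: s x => [|y s IHs] x /=; first by rewrite big_seq1.
by case/andP=> /eqP fx pys; rewrite big_cons IHs // fx.
Qed.

(** A trace identifies the last column index with the first row index, and the successor of the last
    point of a cycle is its first point. So every factor takes its row label at [d] and its column
    label at [f d]. *)
Lemma delta_cycle_prod (f : D -> D) (x : D) (s : seq D) :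
  fcycle f (x :: s) -> uniq (x :: s) ->
  ((\prod_(d <- x :: s) g d)%g == 1%g)%:R =
  \sum_(h | supported t0 (mem (x :: s)) h) #|G|%:R^-1 * (n (tag (h x)))%:R *
    \prod_(d <- x :: s) block_entry (g d) (h d) (h (f d)).
Proof.
move=> cyc uxs; rewrite delta_block_entry ?prod_in //.
rewrite sum_supported_cons; last by case/andP: uxs.
rewrite mulr_sumr; apply: eq_bigr => t _.
rewrite block_entry_prod // mulr_sumr mulr_sumr; apply: eq_bigr => h _.
move: cyc; rewrite /= rcons_path => /andP[pxs /eqP flast].
rewrite -(path_weight_fpath _ pxs) flast mulrA.
by rewrite !ffunE eqxx.
Qed.

End PathExpansion.

End Irreps.

(** * Edge-ends around a vertex, and connectedness *)

Lemma prod_rot_eq1 (gT : finGroupType) (I : Type) (k : nat) (s : seq I)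
    (F : I -> gT) :
  ((\prod_(x <- rot k s) F x)%g == 1%g) = ((\prod_(x <- s) F x)%g == 1%g).
Proof.
rewrite -[s in RHS](cat_take_drop k) /rot !big_cat /=.
by rewrite -eq_invg_mul -[RHS]eq_invg_mul eq_invg_sym eq_sym.
Qed.

Section MapOrbits.

Variable M : rotation_map.

Lemma mem_rot_orbit (d d' : medge M * bool) :
  (d' \in fingraph.orbit (mrot M) d) = (mend d' == mend d).
Proof.
rewrite -fconnect_orbit -mrotP; apply/idP/porbitP => [/iter_findex <-|[m ->]].
  by exists (findex (mrot M) d d'); rewrite permX.
by rewrite permX fconnect_iter.
Qed.

Lemma flow_at_start (gT : finGroupType) (o : medge M -> bool)
    (phi : medge M -> gT) (d : medge M * bool) :
  flow_at o phi (mend d) =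
  ((\prod_(x <- fingraph.orbit (mrot M) d) end_value o phi x)%g == 1%g).
Proof.
apply/forallP/idP => [/(_ d)|flow_d d']; first by rewrite eqxx.
apply/implyP=> /eqP eq_d.
have d'_d : d' \in fingraph.orbit (mrot M) d by rewrite mem_rot_orbit eq_d.
have [k ->] := orbit_rot_cycle (cycle_orbit perm_inj d) (orbit_uniq _ _) d'_d.
by rewrite prod_rot_eq1.
Qed.

Lemma face_permE (d : medge M * bool) : face_perm M d = mrot M (flip d).
Proof. by rewrite permM permE. Qed.

(** Invariance under rotation makes [c] a function of the vertex, and invariance under [flip] makes
    it agree at adjacent vertices; induct on a path. *)
Lemma connected_tag_const (A : eqType) (c : medge M * bool -> A) :
  connected_map M -> (forall d, c (mrot M d) = c d) ->
  (forall d, c (flip d) = c d) -> forall d d', c d = c d'.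
Proof.
move=> [_ conn] c_rot c_flip d d'.
have c_end e e' : mend e' = mend e -> c e = c e'.
  move/eqP; rewrite -mrotP => /porbitP[m ->].
  by elim: m => [|m IHm]; rewrite ?perm1 // expgSr permM c_rot.
have /connectP[p] := conn (mend d) (mend d').
elim: p d => [|v p IHp] d /=; first by move=> _ /c_end.
case/andP=> /existsP[e /andP[/eqP end_e /eqP end_fe]] pathp lastp.
rewrite -end_fe in pathp lastp.
by rewrite -(c_end e d) // -c_flip; apply: IHp.
Qed.

End MapOrbits.

(** * Counting flows by labellings of the edge-ends *)

Section CountFlows.

Variables (C : numClosedFieldType) (gT : finGroupType) (G : {group gT}).
Variables (L : finType) (n : L -> nat).
Variable rho : forall l : L, mx_representation C G (n l).
Hypothesis Hrho : irrep_classes rho.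
Variables (M : rotation_map) (o : medge M -> bool).

Local Notation T := {l : L & 'I_(n l)}.
Local Notation D := (medge M * bool)%type.
Implicit Type i : {ffun D -> T}.

(** The indicator left by Schur orthogonality at [e]. The last two conjuncts say that [i] is
    unchanged by [face_perm] at the two ends of [e]. *)
Definition edge_compatible i (e : medge M) : bool :=
  [&& tag (i (e, o e)) == tag (i (mrot M (e, o e))),
      i (e, o e) == i (mrot M (e, ~~ o e))
    & i (mrot M (e, o e)) == i (e, ~~ o e)].

(** The value [phi e] enters only at the two ends of [e], once as it is and once inverted, so the
    sum over [phi] factors over the edges and orthogonality applies to each. *)
Lemma sum_edge_entries i :
  \sum_(phi in ffun_on (mem G))
     \prod_(d : D) block_entry rho (end_value o phi d) (i d) (i (mrot M d)) =
  \prod_(e : medge M) (#|G|%:R / (n (tag (i (e, o e))))%:R *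
    (edge_compatible i e)%:R) :> C.
Proof.
rewrite [RHS](eq_bigr (fun e => \sum_(g in G)
  block_entry rho g (i (e, o e)) (i (mrot M (e, o e))) *
  block_entry rho g^-1%g (i (e, ~~ o e)) (i (mrot M (e, ~~ o e))))); last first.
  by move=> e _; rewrite (block_entry_orthogonality Hrho).
rewrite bigA_distr_big; apply: eq_bigr => phi _.
transitivity (\prod_e \prod_b
  block_entry rho (end_value o phi (e, b)) (i (e, b)) (i (mrot M (e, b)))).
  by rewrite pair_bigA; apply: eq_bigr => -[].
apply: eq_bigr => e _; rewrite (bigD1 (o e)) //= (bigD1 (~~ o e)) /=; last first.
  by case: (o e).
rewrite big1 ?mulr1 => [|b]; last by case: b (o e) => [] [].
by rewrite /end_value /= eqxx; case: (o e).
Qed.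

Lemma card_tag_fiber (l : L) : #|[pred t : T | tag t == l]| = n l.
Proof.
rewrite -sum1_card.
transitivity (\sum_(k | k == l) \sum_(i < n k) 1)%N.
  by rewrite sig_big_dep; apply: eq_bigl => t; rewrite andbT.
by rewrite big_pred1_eq sum1_card card_ord.
Qed.

Lemma edge_compatibleP i :
  reflect ((forall d, i (face_perm M d) = i d) /\
           (forall d, tag (i (mrot M d)) = tag (i d)))
          [forall e, edge_compatible i e].
Proof.
apply: (iffP forallP) => [comp|[face_i tag_i] e].
  have face_i d : i (face_perm M d) = i d.
    case: d => e b; rewrite face_permE /flip /=.
    have /and3P[_ /eqP eq1 /eqP eq2] := comp e.
    have [->|] := eqVneq b (o e); first by rewrite -eq1.
    by case: b (o e) eq1 eq2 => [] [] //= _ ->.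
  split=> // -[e b]; have /and3P[/eqP eq0 /eqP eq1 /eqP eq2] := comp e.
  have [->|ne_b] := eqVneq b (o e); first by rewrite eq0.
  have -> : b = ~~ o e by case: b (o e) ne_b => [] [].
  by rewrite -eq1 eq0 eq2.
have face1 := face_i (e, o e); have face2 := face_i (e, ~~ o e).
rewrite !face_permE /flip /= ?negbK in face1 face2.
by rewrite /edge_compatible tag_i face1 face2 !eqxx.
Qed.

Hypothesis HM : connected_map M.

(** Tags are preserved by rotation and by face steps, hence by [flip]; connectedness makes them all
    equal to the tag at [d0]. *)
Lemma edge_compatible_tag (d0 : D) (l : L) i :
  [forall e, edge_compatible i e] && (tag (i d0) == l) =
  [forall d, tag (i d) == l] && [forall d, i (face_perm M d) == i d].
Proof.
apply/andP/andP => [[/edge_compatibleP[face_i tag_i] /eqP tag0]|].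
  split; apply/forallP=> d; last exact/eqP/face_i.
  rewrite -tag0; apply/eqP.
  apply: (connected_tag_const (c := fun d => tag (i d)) HM) => // d1.
  by rewrite -(tag_i (flip d1)) -face_permE face_i.
move=> [/forallP tag_i /forallP face_i]; split; last exact: tag_i.
apply/edge_compatibleP; split=> d; first exact/eqP/face_i.
by rewrite !(eqP (tag_i _)).
Qed.

Lemma card_local_flows_prod (x : mvertex M -> D) :
  (forall v, mend (x v) = v) ->
  #|local_flows G o|%:R = \sum_(phi in ffun_on (mem G)) \prod_(v : mvertex M)
    ((\prod_(d <- fingraph.orbit (mrot M) (x v)) end_value o phi d)%g == 1%g)%:R
  :> C.
Proof.
move=> xK; rewrite -sum1_card natr_sum /local_flows.
rewrite big_mkcond [RHS]big_mkcond /=; apply: eq_bigr => phi _; rewrite inE.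
case: (_ \in _) => //=.
have [/forallP flow|/forallPn[v nflow]] := boolP [forall v, flow_at o phi v].
  by rewrite big1 // => v _; rewrite -flow_at_start xK flow.
by rewrite (bigD1 v) //= -flow_at_start xK (negbTE nflow) mul0r.
Qed.

(** Each vertex condition is expanded over labellings of the ends at that vertex, starting from the
    chosen end [x v]. These glue to labellings of all ends, after which the sum over flows is done
    first. *)
Lemma card_local_flows_sum (t0 : T) (x : mvertex M -> D) :
  (forall v, mend (x v) = v) ->
  #|local_flows G o|%:R =
  \sum_(i : {ffun D -> T}) (\prod_v (#|G|%:R^-1 * (n (tag (i (x v))))%:R)) *
   \prod_(e : medge M) (#|G|%:R / (n (tag (i (e, o e))))%:R *
     (edge_compatible i e)%:R) :> C.
Proof.
move=> xK; rewrite (card_local_flows_prod xK).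
transitivity (\sum_(phi in ffun_on (mem G)) \sum_(i : {ffun D -> T})
   \prod_v (#|G|%:R^-1 * (n (tag (i (x v))))%:R *
     \prod_(d | mend d == v)
       block_entry rho (end_value o phi d) (i d) (i (mrot M d)))).
  apply: eq_bigr => phi /ffun_onP Gphi.
  rewrite -(prod_sum_supported t0 (p := @mend M)
    (F := fun v i => #|G|%:R^-1 * (n (tag (i (x v))))%:R *
     \prod_(d | mend d == v)
       block_entry rho (end_value o phi d) (i d) (i (mrot M d)))); last first.
    (* The factor at [v] sees only labels at [v], since rotation stays at the vertex. *)
    move=> v h h' eqh; rewrite eqh //; congr (_ * _).
    apply: eq_bigr => d /eqP end_d; rewrite !eqh //.
    apply/eqP; rewrite -end_d -mrotP.
    by have := mem_porbit (mrot M) 1 d; rewrite expg1.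
  apply: eq_bigr => v _.
  have Gev d : end_value o phi d \in G.
    by rewrite /end_value; case: ifP; rewrite ?groupV => _; apply: Gphi.
  have mem_orb d : (d \in fingraph.orbit (mrot M) (x v)) = (mend d == v).
    by rewrite mem_rot_orbit xK.
  have := cycle_orbit (@perm_inj _ (mrot M)) (x v).
  have := orbit_uniq (mrot M) (x v).
  have [s def_s] : exists s, fingraph.orbit (mrot M) (x v) = x v :: s.
    by rewrite /fingraph.orbit -orderSpred /=; eexists.
  rewrite def_s => us cs; rewrite (delta_cycle_prod Hrho t0 Gev cs us) -def_s.
  apply: eq_big => [h|h _]; first by apply: eq_forallb => d; rewrite /= mem_orb.
  congr (_ * _); by rewrite big_uniq ?orbit_uniq //; apply: eq_bigl.
rewrite exchange_big /=; apply: eq_bigr => i _; rewrite -sum_edge_entries.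
rewrite mulr_sumr; apply: eq_bigr => phi _.
rewrite big_split /=; congr (_ * _).
by rewrite [RHS](partition_big (@mend M) predT).
Qed.

Lemma card_local_flows_irr (d0 : D) (t0 : T) (x : mvertex M -> D) :
  (forall v, mend (x v) = v) ->
  #|local_flows G o|%:R = \sum_(l : L) (#|G|%:R^-1 * (n l)%:R) ^+ #|mvertex M| *
     (#|G|%:R / (n l)%:R) ^+ #|medge M| *
     (n l)%:R ^+ #|porbits (face_perm M)| :> C.
Proof.
move=> xK; rewrite (card_local_flows_sum t0 xK).
pose W l : C := (#|G|%:R^-1 * (n l)%:R) ^+ #|mvertex M| *
     (#|G|%:R / (n l)%:R) ^+ #|medge M|.
(* A surviving labelling has a single tag, read at [d0], so its weight is [W] of that tag; sorting
   by tag then leaves a count of face-invariant labellings. *)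
transitivity (\sum_(i : {ffun D -> T} | [forall e, edge_compatible i e])
  W (tag (i d0))).
  rewrite [RHS]big_mkcond; apply: eq_bigr => i _.
  have [comp|/forallPn[e ncomp]] := boolP [forall e, edge_compatible i e].
    have /esym := edge_compatible_tag d0 (tag (i d0)) i.
    rewrite comp eqxx => /andP[/forallP tag_i _].
    rewrite /W -!prodr_const; congr (_ * _); apply: eq_bigr => e _.
      by rewrite (eqP (tag_i _)).
    by rewrite (eqP (tag_i _)) (forallP comp) mulr1.
  by rewrite [X in _ * X](bigD1 e) //= (negbTE ncomp) mulr0 mul0r mulr0.
rewrite (partition_big (fun i => tag (i d0)) predT) //=.
apply: eq_bigr => l _.
rewrite (eq_bigl _ _ (edge_compatible_tag d0 l)).
rewrite (eq_bigr (fun=> W l)) => [|i /andP[/forallP tag_i _]]; last first.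
  by rewrite (eqP (tag_i _)).
rewrite -big_set sumr_const.
have := card_cycle_invariant t0 (face_perm M) [pred t : T | tag t == l].
rewrite card_tag_fiber => ->.
by rewrite -[LHS]mulr_natr natrX.
Qed.

End CountFlows.

(** * Isolated vertices, and the final formula *)

Lemma isolated_eq0 (M : rotation_map) (d0 : medge M * bool) :
  connected_map M -> isolated M = set0.
Proof.
move=> [_ conn]; apply/setP=> v; rewrite !inE; apply/negbTE.
have /connectP[[|w p] /=] := conn v (mend d0).
  by move=> _ <-; apply/forallPn; exists d0; rewrite negbK.
case/andP=> /existsP[d /andP[/eqP end_d _]] _ _.
by apply/forallPn; exists d; rewrite negbK end_d.
Qed.

Lemma connected_edgeless_card (M : rotation_map) :
  connected_map M -> #|medge M| = 0%N -> #|mvertex M| = 1%N.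
Proof.
move=> [V_gt0 conn] E0; have [v _] := card_gt0P V_gt0.
apply/eqP; rewrite -cardsT; apply/cards1P; exists v; apply/setP=> w; rewrite !inE.
have /connectP[[|u p] /= path_p ->] := conn v w; first by rewrite eqxx.
by case/andP: path_p => /existsP[[e b] _] _; have := card0_eq E0 e.
Qed.

Lemma card_local_flows_field (C : numClosedFieldType) (gT : finGroupType)
    (G : {group gT}) (L : finType) (n : L -> nat)
    (rho : forall l : L, mx_representation C G (n l))
    (M : rotation_map) (o : medge M -> bool) :
  irrep_classes rho -> connected_map M ->
  (#|local_flows G o|%:R : C) =
    #|G|%:R ^ (#|medge M|%:Z - #|mvertex M|%:Z) *
    \sum_(l : L) (n l)%:R ^ euler_char M.
Proof.
move=> Hrho HM; have [irr_rho _ _] := Hrho.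
have G_neq0 := @natf_card_neq0 C _ G.
have n_neq0 l := irr_nat_neq0 (irr_rho l).
(* Without edges the map is one vertex on the sphere: there is one flow and the Euler characteristic
   is 2, so the claim becomes that the squares of the [n l] sum to the order of [G]. *)
have [d0 _|noD] := pickP (@predT (medge M * bool)%type); last first.
  have E0 : #|medge M| = 0%N by apply: eq_card0 => e; have := noD (e, true).
  have V1 := connected_edgeless_card HM E0.
  have F1 : nfaces M = 1%N.
    rewrite /nfaces (_ : porbits _ = set0) ?cards0 ?add0n; last first.
      by apply/setP=> X; rewrite inE; apply/imsetP=> -[d _ _]; have := noD d.
    rewrite -V1; apply: eq_card => v; rewrite !inE.
    by apply/forallP=> d; have := noD d.
  rewrite /euler_char V1 E0 F1 (_ : #|local_flows G o| = 1%N).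
    have := sum_irr_trace Hrho (group1 G); rewrite eqxx mulr1.
    under eq_bigr do rewrite repr_mx1 mxtrace1 -expr2.
    by move=> sumE; rewrite [X in _ * X]sumE mulVf.
  apply/eqP/cards1P; exists [ffun=> 1%g]; apply/setP=> phi; rewrite !inE.
  have noE (e : medge M) : False by have := noD (e, true).
  have -> : phi = [ffun=> 1%g] by apply/ffunP=> e; case: (noE e).
  rewrite eqxx; apply/andP; split; apply/forallP; first by move=> e; case: (noE e).
  by move=> v; apply/forallP=> -[e b]; case: (noE e).
(* Some irreducible must exist to provide the default label [t0]; otherwise the regular character at
   1 would be an empty sum. *)
have [l0 _|L0] := pickP (@predT L); last first.
  have := sum_irr_trace Hrho (group1 G); rewrite big_pred0 // eqxx mulr1.
  by move/esym/eqP; rewrite (negbTE G_neq0).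
pose t0 : {l : L & 'I_(n l)} := Tagged _ (Ordinal (irr_gt0 (irr_rho l0))).
have no_iso := isolated_eq0 d0 HM.
have /fin_all_exists[x xK] v : exists d : medge M * bool, mend d = v.
  move/setP/(_ v): no_iso; rewrite !inE => /negbT/forallPn[d].
  by rewrite negbK => /eqP; exists d.
rewrite (card_local_flows_irr Hrho o HM d0 t0 xK) mulr_sumr.
apply: eq_bigr => l _.
rewrite /euler_char /nfaces no_iso cards0 addn0.
rewrite !exprMn !exprVn !expfzDr ?G_neq0 ?n_neq0 // -!exprnN -!exprnP.
rewrite !mulrA; congr (_ / _ * _).
by rewrite mulrAC; congr (_ * _); apply: mulrC.
Qed.

Theorem theorem5p2 (R : realType) (gT : finGroupType) (G : {group gT})
    (L : finType) (n : L -> nat)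
    (rho : forall l : L, mx_representation (R[i])%C G (n l))
    (Hrho : irrep_classes rho)
    (M : rotation_map) (HM : connected_map M) (o : medge M -> bool) :
  (#|local_flows G o|%:R : rat) =
    #|G|%:R ^ (#|medge M|%:Z - #|mvertex M|%:Z) *
    \sum_(l : L) (n l)%:R ^ euler_char M.
Proof.
(* The exponents may be negative, so the identity lives in the rationals; it is checked after the
   injective embedding into the complex field. *)
apply: (fmorph_inj (@ratr (R[i])%C)).
rewrite rmorph_nat rmorphM rmorph_sum /= fmorphXz rmorph_nat.
rewrite (card_local_flows_field o Hrho HM); congr (_ * _).
by apply: eq_bigr => l _; rewrite fmorphXz rmorph_nat.
Qed.
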